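(* Let $T$ be a tournament on strategies $\{1,\dots,n\}$, viewed as a Rock Paper Scissors variant, with Nash equilibrium $\vec a$. If strategy $s$ dominates strategy $t$, then $a_t=0$.
   Context: A Rock Paper Scissors variant is given by a tournament on strategies $\{1,\dots,n\}$: for distinct $i,j$ exactly one of ''$i$ beats $j$'' or ''$j$ beats $i$'' holds. Define $g_{ij}=2$ if $i$ beats $j$, $g_{ii}=1$, and $g_{ij}=0$ if $j$ beats $i$. A strategy profile is a vector $\vec a$ with $a_i\ge 0$ and $\sum_i a_i=1$. A Nash equilibrium is a strategy profile $\vec a$ such that for every strategy profile $\vec b$, $\sum_{i,j} g_{ij}a_ib_j\ge 1$; it is unique for such games. Strategy $s$ dominates strategy $t$ if $s$ beats $t$ and there is no other strategy $k$ such that $t$ beats $k$ and $k$ beats $s$. *)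

(* Defs.v *)
From HB Require Import structures.
From mathcomp Require Import all_boot all_order all_algebra.
From mathcomp Require Import reals.

Set Implicit Arguments.
Unset Strict Implicit.
Unset Printing Implicit Defensive.

Import Order.TTheory GRing.Theory Num.Theory.
Local Open Scope ring_scope.

(* [T i j] reads "i beats j". *)
Definition tournament (n : nat) (T : rel 'I_n) : Prop :=
  irreflexive T /\ forall i j : 'I_n, i != j -> T i j (+) T j i.

Definition payoff (R : realType) (n : nat) (T : rel 'I_n) : 'M[R]_n :=
  \matrix_(i, j) (if i == j then 1 else if T i j then 2 else 0).

Definition strategy_profile (R : realType) (n : nat) (a : 'rV[R]_n) : Prop :=
  (forall i, 0 <= a 0 i) /\ \sum_i a 0 i = 1.

Definition nash_equilibrium (R : realType) (n : nat) (T : rel 'I_n)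
    (a : 'rV[R]_n) : Prop :=
  strategy_profile a /\
  forall b : 'rV[R]_n, strategy_profile b ->
    1 <= \sum_i \sum_j payoff R T i j * a 0 i * b 0 j.

Definition dominates (n : nat) (T : rel 'I_n) (s t : 'I_n) : Prop :=
  T s t /\ ~ exists k : 'I_n, [/\ k <> s, k <> t, T t k & T k s].

(* Main.v *)
Require Import Defs.
From HB Require Import structures.
From mathcomp Require Import all_boot all_order all_algebra.
From mathcomp Require Import reals lra.

Import Order.TTheory GRing.Theory Num.Theory.
Local Open Scope ring_scope.

(** Let [c j] be the payoff of the equilibrium [a] against the pure strategy
    [j].  Every [c j] is at least [1], while the average of [c] weighted by [a]
    is exactly [1], since the game is symmetric.  If [s] dominates [t], then
    every strategy scores at least as well against [t] as against [s], and [t]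
    itself scores [1] more, so [c t >= c s + a t >= 1 + a t].  The average is
    then at least [1 + (a t)^2], which forces [a t = 0]. *)

Definition payoff_against {R : realType} {n : nat} (T : rel 'I_n)
    (a : 'rV[R]_n) (j : 'I_n) : R :=
  \sum_i payoff R T i j * a 0 i.

(** Equivalently, subtracting the all-ones matrix from [payoff] leaves a skew-symmetric matrix. *)
Lemma payoff_skew (R : realType) (n : nat) (T : rel 'I_n) (i j : 'I_n) :
  tournament T -> payoff R T i j + payoff R T j i = 2.
Proof.
move=> [_ tourT]; rewrite !mxE [j == i]eq_sym.
have [//|/tourT] := eqVneq i j.
by case: (T i j); case: (T j i) => // _; rewrite ?addr0 ?add0r.
Qed.

Lemma pure_strategy_profile (R : realType) (n : nat) (j : 'I_n) :
  strategy_profile (delta_mx 0 j : 'rV[R]_n).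
Proof.
split=> [i|]; first by rewrite mxE ler0n.
rewrite (bigD1 j) //= big1 ?addr0 ?mxE ?eqxx // => i ij.
by rewrite mxE (negPf ij).
Qed.

Lemma nash_payoff_against_ge1 (R : realType) (n : nat) (T : rel 'I_n)
    (a : 'rV[R]_n) (j : 'I_n) :
  nash_equilibrium T a -> 1 <= payoff_against T a j.
Proof.
move=> [_ /(_ _ (pure_strategy_profile R n j))] /le_trans; apply.
rewrite le_eqVlt; apply/orP; left; apply/eqP/eq_bigr => i _.
rewrite (bigD1 j) //= big1 ?addr0 ?mxE ?eqxx ?mulr1 // => k kj.
by rewrite [delta_mx _ _ _ _]mxE (negPf kj) andbF mulr0.
Qed.

Lemma self_payoff (R : realType) (n : nat) (T : rel 'I_n) (a : 'rV[R]_n) :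
  tournament T -> strategy_profile a ->
  \sum_j payoff_against T a j * a 0 j = 1.
Proof.
move=> tourT [_ suma].
set S := LHS.
have SE : S = \sum_j \sum_i payoff R T i j * a 0 i * a 0 j.
  by apply: eq_bigr => j _; rewrite mulr_suml.
(* Exchanging the two indices in one copy of [S] pairs each entry with its transpose, so
   [payoff_skew] reduces the total to twice the square of the sum of [a]. *)
have SS : S + S = 2.
  rewrite {1}SE exchange_big SE -big_split /=.
  transitivity (\sum_j 2 * a 0 j); last by rewrite -mulr_sumr suma mulr1.
  apply: eq_bigr => j _; rewrite -big_split /=.
  transitivity (\sum_i 2 * a 0 j * a 0 i).
    apply: eq_bigr => i _.
    by rewrite -(payoff_skew R n T i j tourT) !mulrDl addrC mulrAC.
  by rewrite -mulr_sumr suma mulr1.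
lra.
Qed.

Lemma dominates_payoff_le (R : realType) (n : nat) (T : rel 'I_n)
    (s t i : 'I_n) :
  tournament T -> dominates T s t ->
  payoff R T i s + (i == t)%:R <= payoff R T i t.
Proof.
move=> [irrT tourT] [Tst nodom]; rewrite !mxE.
have st : s != t by apply/eqP => st; rewrite st irrT in Tst.
have [->|it] := eqVneq i t.
  rewrite eq_sym (negPf st); have := tourT _ _ st; rewrite Tst /=.
  by case: (T t s) => // _; rewrite add0r.
have [->|si] := eqVneq i s; first by rewrite Tst addr0 ler1n.
case: ifP => Tis; last by case: ifP => _; rewrite addr0 ?ler0n.
(* Here [i] beats [s]; if it failed to beat [t], it would be the intermediate strategy that
   domination forbids. *)
have := tourT _ _ it; case Tit: (T i t) => /=; first by rewrite addr0.
by move=> Tti; case: nodom; exists i; split=> //; apply/eqP.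
Qed.

Theorem theorem3p3 (R : realType) (n : nat) (T : rel 'I_n) (a : 'rV[R]_n)
    (s t : 'I_n) :
  tournament T -> nash_equilibrium T a -> dominates T s t -> a 0 t = 0.
Proof.
move=> tourT nasha dom.
have [[a_ge0 suma] _] := nasha.
have cs := @nash_payoff_against_ge1 R n T a s nasha.
have ct : payoff_against T a s + a 0 t <= payoff_against T a t.
  (* Spreading [a 0 t] over all indices allows a termwise comparison by [dominates_payoff_le]. *)
  have -> : a 0 t = \sum_i (i == t)%:R * a 0 i.
    rewrite (bigD1 t) //= eqxx mul1r big1 ?addr0 // => i it.
    by rewrite (negPf it) mul0r.
  rewrite -big_split; apply: ler_sum => i _ /=.
  by rewrite -mulrDl ler_wpM2r // dominates_payoff_le.
have avg : 1 + a 0 t * a 0 t <= \sum_j payoff_against T a j * a 0 j.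
  (* The term at [t] absorbs the whole surplus, through [cs] and [ct]; the other terms need only the
     bound by 1. *)
  rewrite -{1}suma (bigD1 t) //= [leRHS](bigD1 t) //= addrAC lerD //.
    by rewrite -{1}[a 0 t]mul1r -mulrDl ler_wpM2r //; lra.
  apply: ler_sum => j _.
  by rewrite -{1}[a 0 j]mul1r ler_wpM2r // nash_payoff_against_ge1.
rewrite self_payoff // in avg.
apply/eqP; rewrite -sqrf_eq0 expr2 eq_le mulr_ge0 // andbT; lra.
Qed.
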